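(* Let $\mathbb{K}$ be a field and $n \in \mathbb{N}$. For each $i \in \{1,\ldots,n\}$ let $U_i$ be a finite subset of $\mathbb{K}$ and $S_i : U_i \to \mathbb{N}_0$ a multiset, and let $S = S_1 \times \cdots \times S_n$ be the multigrid with domain $U_1 \times \cdots \times U_n$. Let $f \in \mathbb{K}[x_1,\ldots,x_n]$ and let $\alpha = (\alpha_1,\ldots,\alpha_n)$, $\lambda = (\lambda_1,\ldots,\lambda_n) \in \mathbb{N}_0^n$. Assume each $S_i$ is $\lambda_i$-null. Let $\|S_i\| := \sum_{u \in U_i} S_i(u)$. Assume $\alpha_i < \|S_i\|$ for all $i$ and that $f$ contains the monomial $x_1^{\alpha_1}\cdots x_n^{\alpha_n}$. Assume further that for every monomial $x^\gamma$ appearing in $f$ with $\gamma \neq \alpha$ there is $i$ such that \[ \gamma_i \in [0, \alpha_i - 1] \cup [\alpha_i + 1, \|S_i\| - 1] \cup [\|S_i\|, \alpha_i + \lambda_i]. \] Then $f$ does not vanish on the multigrid $S$.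
   Context: For integers $a,b$, $[a,b] := \{x \in \mathbb{N}_0 \mid a \le x \le b\}$ (empty if $a>b$). A multiset is a map $T: U \to \mathbb{N}_0$ from a finite set $U$ (its domain). The multigrid $S = S_1 \times \cdots \times S_n$ is the map on $U_1 \times\cdots\times U_n$ with $S(u_1,\ldots,u_n) = (S_1(u_1),\ldots,S_n(u_n))$. A point $\mathbf{c} \in \mathbb{K}^n$ is a zero of $f$ with multiplicity vector $(m_1,\ldots,m_n)$ if $f(x_1+c_1,\ldots,x_n+c_n) \in \langle x_1^{m_1},\ldots,x_n^{m_n}\rangle$. $f$ vanishes on the multigrid $S$ if every $\mathbf{u} \in U_1\times\cdots\times U_n$ is a zero of $f$ with multiplicity vector $S(\mathbf{u})$. For $\lambda \in \mathbb{N}_0$, a univariate polynomial of degree $\nu$ is $\lambda$-lacunary if all coefficients of $x^k$ with $\nu-\lambda \le k < \nu$ vanish; the multiset $S_i$ is $\lambda_i$-null if $\prod_{u \in U_i}(x - u)^{S_i(u)}$ is $\lambda_i$-lacunary. *)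

(* Defs.v *)
From mathcomp Require Import all_boot all_order all_algebra finmap mpoly.

Set Implicit Arguments.
Unset Strict Implicit.
Unset Printing Implicit Defensive.

Import GRing.Theory.
Local Open Scope ring_scope.

(* The endpoints are integers so that [0, a - 1] is empty when a = 0; with
   truncated subtraction on nat it would contain 0. *)
Definition interval_nat (a b : int) : pred nat :=
  fun x => (a <= x%:Z) && (x%:Z <= b).

Section Multiset.
Variables (K : fieldType) (U : {fset K}) (T : U -> nat).

Definition multiset_size : nat := (\sum_(u : U) T u)%N.

Definition multiset_poly : {poly K} :=
  \prod_(u : U) ('X - (val u)%:P) ^+ T u.

End Multiset.

(* Truncating nu - lam at 0 is harmless, since k ranges over nat. *)
Definition lacunary (K : fieldType) (lam : nat) (p : {poly K}) : Prop :=
  let nu := (size p).-1 in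
  forall k : nat, (nu - lam <= k < nu)%N -> p`_k = 0.

Definition null_multiset (K : fieldType) (lam : nat) (U : {fset K})
    (T : U -> nat) : Prop :=
  lacunary lam (multiset_poly T).

Section Multigrid.
Variables (K : fieldType) (n : nat).

Definition in_ideal (g : 'I_n -> {mpoly K[n]}) (p : {mpoly K[n]}) : Prop :=
  exists q : 'I_n -> {mpoly K[n]}, p = \sum_(i < n) q i * g i.

Definition translate (f : {mpoly K[n]}) (c : 'I_n -> K) : {mpoly K[n]} :=
  f \mPo [tuple 'X_i + (c i)%:MP | i < n].

Definition zero_with_multiplicity (f : {mpoly K[n]}) (c : 'I_n -> K)
    (m : 'I_n -> nat) : Prop :=
  in_ideal (fun i => 'X_i ^+ m i) (translate f c).

Definition multigrid (U : 'I_n -> {fset K}) (S : forall i, U i -> nat)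
    (u : forall i, U i) : 'I_n -> nat :=
  fun i => S i (u i).

Definition vanishes_on_multigrid (U : 'I_n -> {fset K})
    (S : forall i, U i -> nat) (f : {mpoly K[n]}) : Prop :=
  forall u : (forall i, U i),
    zero_with_multiplicity f (fun i => val (u i)) (multigrid S u).

End Multigrid.

(* Main.v *)
From HB Require Import structures.
Require Import Defs.
From mathcomp Require Import all_boot all_order all_algebra finmap mpoly.
From mathcomp Require Import ssrcomplements zify.

(** Let g_i be the polynomial of S_i and let L_i send p to the coefficient of
    x^alpha_i in p mod g_i.  Because g_i is lambda_i-lacunary, L_i kills x^k for
    every k <> alpha_i with k < ||S_i|| or k <= alpha_i + lambda_i, and
    L_i(x^alpha_i) = 1; hence the tensor product of the L_i maps f to its
    coefficient at alpha.  By the Chinese remainder theorem L_i is a sum over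
    u in U_i of functionals killing the multiples of (x - u)^S_i(u).  Expanding
    the tensor product gives one term per grid point, and each term kills every
    f with the prescribed multiplicity at that point. *)

Set Implicit Arguments.
Unset Strict Implicit.

Import GRing.Theory.
Local Open Scope ring_scope.

Section TensorFunctional.
Variables (K : fieldType) (n : nat).

(** Linear in [p] for arbitrary maps [M i], since only their values on powers of ['X] enter. *)
Definition tensor (M : 'I_n -> {poly K} -> K) (p : {mpoly K[n]}) : K :=
  \sum_(m <- msupp p) p@_m * \prod_i M i 'X^(m i).

(** Provides a summation range independent of [p], so that the values at several polynomials can be
    added term by term. *)
Lemma tensorwE M p k : (msize p <= k)%N ->
  tensor M p = \sum_(m : 'X_{1..n < k}) p@_m * \prod_i M i 'X^(m i).
Proof.
move=> le_pk; set I : subFinType _ := 'X_{1..n < k}.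
rewrite /tensor (big_mksub I) ?msupp_uniq //=; first last.
  by move=> x /msize_mdeg_lt /leq_trans; apply.
by rewrite big_rmcond //= => j /memN_msupp_eq0 ->; rewrite mul0r.
Qed.

Lemma tensor_is_scalar M : scalar (tensor M).
Proof.
move=> c p q; pose k := maxn (msize (c *: p + q)) (maxn (msize p) (msize q)).
rewrite !(@tensorwE _ _ k) ?leq_max ?leqnn ?orbT //.
rewrite mulr_sumr -big_split; apply: eq_bigr => m _ /=.
by rewrite mcoeffD mcoeffZ mulrDl mulrA.
Qed.

HB.instance Definition _ M :=
  GRing.isLinear.Build K {mpoly K[n]} K *%R (tensor M) (tensor_is_scalar M).

Lemma tensorX M m : tensor M 'X_[m] = \prod_i M i 'X^(m i).
Proof. by rewrite /tensor msuppX big_seq1 mcoeffX eqxx mul1r. Qed.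

(** For a monomial [q] of exponent [m], the value factors as the product of [M j 'X^(m j)] over
    [j != i] times [M i ('X^(m i) * g)]; linearity in [q] does the rest. *)
Lemma tensor_mul_poly_eq0 (M : 'I_n -> {scalar {poly K}}) i (g : {poly K}) q :
  (forall p, g %| p -> M i p = 0) ->
  tensor M (q * (map_poly (@mpolyC n K) g).['X_i]) = 0.
Proof.
move=> Mg; rewrite {1}[q]mpolyE mulr_suml raddf_sum big1 // => m _ /=.
rewrite -scalerAl linearZ /= [tensor _ _](_ : _ = 0) ?mulr0 //.
rewrite horner_coef size_map_poly mulr_sumr raddf_sum /=.
transitivity ((\prod_(j | j != i) M j 'X^(m j)) * M i ('X^(m i) * g)).
  rewrite -[in RHS](coefK g) poly_def mulr_sumr raddf_sum mulr_sumr.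
  apply: eq_bigr => k _ /=.
  rewrite coef_map /= mul_mpolyC -!scalerAr !linearZ /= mulrCA -exprD.
  rewrite mpolyXn -mpolyXD tensorX.
  congr (_ * _); rewrite (bigD1 i) //= mulrC mnmDE mulmnE mnm1E eqxx mul1n.
  congr (_ * _); apply: eq_bigr => j ji.
  by rewrite mnmDE mulmnE mnm1E eq_sym (negPf ji) mul0n addn0.
by rewrite Mg ?mulr0 // dvdp_mulIr.
Qed.

(** Serves to turn ideal membership of the translate into an expression of [f] through powers of
    ['X_i - c i]. *)
Lemma translateK (f : {mpoly K[n]}) c :
  translate f c \mPo [tuple 'X_i - (c i)%:MP | i < n] = f.
Proof.
rewrite /translate (comp_mpolyEX f) raddf_sum [RHS]mpolyE /=.
apply: eq_bigr => m _; rewrite linearZ /=; congr (_ *: _).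
rewrite comp_mpolyX rmorph_prod [RHS]mpolyXE_id /=; apply: eq_bigr => i _.
by rewrite rmorphXn /= tnth_mktuple comp_mpolyD comp_mpolyC comp_mpolyXU
  -tnth_nth tnth_mktuple subrK.
Qed.

End TensorFunctional.

(** Distributivity when the index type of the inner sum depends on [i]; [fprod U] will be the set of
    grid points. *)
Lemma prod_sum_fprod (R : comNzRingType) (I : finType) (T : I -> finType)
    (F : forall i, T i -> R) :
  \prod_i \sum_(u : T i) F i u = \sum_(t : fprod T) \prod_i F i (t i).
Proof.
transitivity (\sum_(t : fprod T) \prod_(i in I) [ffun u => F i u] (t i)).
  rewrite big_fprod; under eq_bigr do rewrite (big_tag F).
  rewrite bigA_distr_big_dep; apply: eq_bigr => h _; apply: eq_bigr => i _.
  by rewrite /untag; case: eqP => // e; rewrite ffunE.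
by apply: eq_bigr => t _; apply: eq_bigr => i _; rewrite ffunE.
Qed.

Section Univariate.
Variable K : fieldType.
Implicit Types (g e p : {poly K}) (a k : nat).

(** Taking [e = 1] gives the functional to be split; a Chinese remainder idempotent modulo [g] gives
    its piece at one point. *)
Definition modp_coef g e a p : K := (e * p %% g)`_a.

Lemma modp_coef_is_scalar g e a : scalar (modp_coef g e a).
Proof.
by move=> c p q; rewrite /modp_coef mulrDr -scalerAr modpD modpZl coefD coefZ.
Qed.

HB.instance Definition _ g e a :=
  GRing.isLinear.Build K {poly K} K *%R (modp_coef g e a)
    (modp_coef_is_scalar g e a).

Lemma partition_of_unity_mod (I : eqType) (s : seq I) (P : I -> {poly K}) :
  uniq s -> {in s &, forall x y, x != y -> coprimep (P x) (P y)} ->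
  exists e : I -> {poly K},
    \prod_(u <- s) P u %| 1 - \sum_(u <- s) e u /\
    {in s, forall u, \prod_(u <- s) P u %| P u * e u}.
Proof.
elim: s => [|x s IHs] /=; first by exists (fun=> 0); rewrite !big_nil dvd1p.
case/andP=> xNs us cop.
have [|e [He1 He2]] := IHs us.
  by move=> y z ys zs; apply: cop; rewrite inE ?ys ?zs orbT.
have neqx u : u \in s -> (u == x) = false.
  by move=> us'; apply: contraNF xNs => /eqP <-.
set Q := \prod_(u <- s) P u in He1 He2 *.
have /Bezout_eq1_coprimepP [[a b] /= ab1] : coprimep (P x) Q.
  rewrite /Q big_seq; apply: (big_ind (coprimep (P x))) => [|p q|u us'].
  - exact: coprimep1.
  - by rewrite coprimepMr => -> ->.
  - by apply: cop; rewrite ?inE ?eqxx ?us' ?orbT // eq_sym neqx.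
(* Since [a * P x + b * Q = 1], the new difference between 1 and the sum is [a * P x] times the old
   one, hence divisible by [P x * Q]. *)
exists (fun u => if u == x then b * Q else a * P x * e u).
rewrite !big_cons eqxx -/Q; split.
  have -> : \sum_(u <- s) (if u == x then b * Q else a * P x * e u) =
            a * P x * \sum_(u <- s) e u.
    by rewrite mulr_sumr !big_seq; apply: eq_bigr => u /neqx ->.
  rewrite -ab1 opprD addrA addrK -[X in X - _]mulr1 -mulrBr -mulrA.
  by rewrite dvdp_mull // dvdp_mul.
move=> u; rewrite inE; case: eqP => [-> _ | _ /= us'].
  by rewrite mulrCA dvdp_mull // dvdpp.
by rewrite mulrCA -mulrA dvdp_mull // dvdp_mul // He2.
Qed.

Lemma modXn_coef_eq0 g lam a k :
  g \is monic -> (a < (size g).-1)%N -> lacunary lam g ->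
  (k != a)%N -> (k < (size g).-1)%N || (k <= a + lam)%N ->
  ('X^k %% g)`_a = 0.
Proof.
move=> mong alt lac kNa; have g_gt0 : (0 < size g)%N by case: (size g) alt.
have [ltk _|lek /= lekal] := ltnP k (size g).-1.
  rewrite modp_small; first by rewrite coefXn eq_sym (negPf kNa).
  by rewrite size_polyXn -ltn_predRL.
set nu := (size g).-1 in alt lac lek.
(* By lacunarity, one reduction step already brings the size down to a. *)
pose r := 'X^k - 'X^(k - nu) * g.
have r0 j : (a <= j)%N -> r`_j = 0.
  move=> leaj; rewrite coefB coefXn coefXnM; case: ltnP => [ltj|lej].
    rewrite subr0 ltn_eqF //; exact: (leq_trans ltj (leq_subr _ _)).
  have -> : (j == k) = (j - (k - nu) == nu)%N.
    by rewrite -(eqn_add2r (k - nu) (_ - _)) subnK // subnKC.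
  have [ltnu|gtnu|->] := ltngtP (j - (k - nu))%N nu.
  (* From [k <= a + lam <= j + lam], the index [j - (k - nu)] is at least [nu - lam], so it falls in
     the lacunary gap of [g]. *)
  - rewrite lac ?subr0 // ltnu andbT leq_subLR.
    rewrite -(leq_add2r (k - nu)) -addnA subnK // subnKC //.
    by rewrite (leq_trans lekal) // addnC leq_add2l.
  - by rewrite nth_default ?subr0 // -(prednK g_gt0).
  - by rewrite -[g`_nu]/(lead_coef g) (monicP mong) subrr.
have szr : (size r <= a)%N by apply/leq_sizeP.
rewrite -[X in X %% g](subrK ('X^(k - nu) * g)) modpD modp_mull addr0 -/r.
by rewrite modp_small ?r0 // (leq_ltn_trans szr) // (leq_trans alt) ?leq_pred.
Qed.

Variables (U : {fset K}) (T : U -> nat).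

Lemma multiset_poly_monic : multiset_poly T \is monic.
Proof. by apply: monic_prod => u _; apply/monic_exp/monicXsubC. Qed.

Lemma size_multiset_poly : size (multiset_poly T) = (multiset_size T).+1.
Proof.
rewrite size_prod => [|u _]; last by rewrite expf_neq0 ?polyXsubC_eq0.
under eq_bigr do rewrite size_exp_XsubC -addn1.
by rewrite big_split sum1_card /= -addSn addnK.
Qed.

Lemma multiset_partition_of_unity : exists e : U -> {poly K},
  multiset_poly T %| 1 - \sum_u e u /\
  forall u, multiset_poly T %| ('X - (val u)%:P) ^+ T u * e u.
Proof.
have [|u v _ _ uNv|e [He1 He2]] := @partition_of_unity_mod _
    (index_enum U) (fun u => ('X - (val u)%:P) ^+ T u).
- exact: index_enum_uniq.
- apply/coprimep_expl/coprimep_expr/coprimep_XsubC2.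
  by rewrite subr_eq0 (inj_eq val_inj) eq_sym.
- by exists e; split=> // u; apply: He2; rewrite mem_index_enum.
Qed.

End Univariate.

Lemma tensor_modp_coef_eq0 (K : fieldType) (n : nat) (U : 'I_n -> {fset K})
    (S : forall i, U i -> nat) (f : {mpoly K[n]}) (a : 'I_n -> nat) :
  vanishes_on_multigrid S f ->
  tensor (fun i => modp_coef (multiset_poly (S i)) 1 (a i)) f = 0.
Proof.
move=> f_van.
have /fin_all_exists [e e_unit] i := multiset_partition_of_unity (S i).
pose L i (u : U i) := modp_coef (multiset_poly (S i)) (e i u) (a i).
(* The two sides differ by a coefficient of [(1 - \sum_u e i u) * p] modulo the polynomial of [S i],
   which is 0. *)
have sumL i p :
    modp_coef (multiset_poly (S i)) 1 (a i) p = \sum_(u : U i) L i u p.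
  pose g := multiset_poly (S i).
  rewrite -coef_sum -(big_morph (fun q : {poly K} => q %% g) (modpD g) (mod0p g)).
  rewrite -mulr_suml.
  apply/eqP; rewrite -subr_eq0 /modp_coef -coefB -modpN -modpD -mulrBl.
  by rewrite modp_eq0 ?coef0 // dvdp_mulr // (e_unit i).1.
have -> : tensor (fun i => modp_coef (multiset_poly (S i)) 1 (a i)) f =
    \sum_(t : fprod U) tensor (fun i => L i (t i)) f.
  rewrite exchange_big; apply: eq_bigr => m _ /=.
  rewrite -mulr_sumr -(prod_sum_fprod (fun i u => L i u 'X^(m i))).
  by congr (_ * _); apply: eq_bigr => i _.
rewrite big1 // => t _; have [q fq] := f_van t.
(* Undoing the translation at the grid point [t] writes [f] as a sum of multiples of the powers
   [('X_i - t i) ^+ S i (t i)]. *)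
rewrite -[f](translateK _ (fun i => val (t i))) fq.
rewrite (raddf_sum (comp_mpoly _)) raddf_sum big1 //= => i _.
rewrite rmorphM rmorphXn /= comp_mpolyXU -tnth_nth tnth_mktuple.
have -> : 'X_i - (val (t i))%:MP =
    (map_poly (@mpolyC n K) ('X - (val (t i))%:P)).['X_i].
  by rewrite rmorphB /= map_polyX map_polyC hornerXsubC.
rewrite -horner_exp -rmorphXn /=.
apply: (@tensor_mul_poly_eq0 _ _ (fun i => L i (t i))) => p gp.
rewrite /L /= /modp_coef modp_eq0 ?coef0 //.
apply: dvdp_trans ((e_unit i).2 (t i)) _.
by rewrite mulrC dvdp_mul.
Qed.

Unset Implicit Arguments.

Theorem theorem7p2 (K : fieldType) (n : nat) (n_gt0 : (0 < n)%N)
    (U : 'I_n -> {fset K}) (S : forall i : 'I_n, U i -> nat)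
    (f : {mpoly K[n]}) (alpha : 'X_{1..n}) (lam : 'I_n -> nat)
    (S_null : forall i : 'I_n, null_multiset (lam i) (S i))
    (alpha_lt : forall i : 'I_n, (alpha i < multiset_size (S i))%N)
    (alpha_supp : alpha \in msupp f)
    (supp_cond : forall gamma : 'X_{1..n},
       gamma \in msupp f -> gamma != alpha ->
       exists i : 'I_n,
         [\/ gamma i \in interval_nat 0 ((alpha i)%:Z - 1),
             gamma i \in interval_nat ((alpha i)%:Z + 1)
                           ((multiset_size (S i))%:Z - 1)
           | gamma i \in interval_nat (multiset_size (S i))%:Z
                           ((alpha i)%:Z + (lam i)%:Z)]) :
  ~ vanishes_on_multigrid S f.
Proof.
move=> /(tensor_modp_coef_eq0 alpha)/eqP; apply/negP.
have modE i : modp_coef (multiset_poly (S i)) 1 (alpha i) =1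
    fun p => (p %% multiset_poly (S i))`_(alpha i).
  by move=> p; rewrite /modp_coef mul1r.
rewrite /tensor (bigD1_seq alpha) ?msupp_uniq //= [X in _ + X]big_seq_cond.
rewrite [X in _ + X]big1.
  (* In the term at [alpha] each power is its own remainder, so all factors are 1 and the nonzero
     coefficient of [f] is left. *)
  rewrite addr0 big1 ?mulr1 -?mcoeff_msupp // => i _.
  rewrite modE modp_small ?coefXn ?eqxx //.
  by rewrite size_polyXn size_multiset_poly ltnS.
move=> m /andP[m_supp mNalpha]; have [i m_i] := supp_cond m m_supp mNalpha.
rewrite (bigD1 i) //= modE (@modXn_coef_eq0 _ _ (lam i)) ?mul0r ?mulr0 //.
- exact: multiset_poly_monic.
- by rewrite size_multiset_poly.
- exact: S_null.
(* All three intervals avoid [alpha i]; the third begins at the size of [S i], which exceeds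
   [alpha i]. *)
- have := alpha_lt i; case: m_i; rewrite /interval_nat unfold_in /=; lia.
- rewrite size_multiset_poly /=; have := alpha_lt i.
  case: m_i; rewrite /interval_nat unfold_in /=; lia.
Qed.
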